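(* Let $d\ge 2$ and $1\le s\le d-1$ be integers, and let $\beta\in\mathbb{R}^d$ with $|\beta|=1$ have $s$ rational quotients. For a spherical segment $S\subseteq RS^{d-1}$ of opening angle $\theta$ and direction $\beta$, let $\psi(R,\theta,\beta)$ be the number of lattice points (points of $\mathbb{Z}^d$) in $S$. Then \[\psi(R,\theta,\beta) \ll_\beta \kappa_d(R)\left(1+R\theta^{\frac{1}{d-s}}\right)\] as $\theta\to0$ along with $R\to\infty$, where the implied constant may depend on $\beta$ but not on $R$ or $\theta$. That is, there exist constants $C,\theta_0,R_0>0$, depending only on $\beta$ (and $d$), such that for all $R\ge R_0$, all $0<\theta\le\theta_0$ and every spherical segment $S\subseteq RS^{d-1}$ of direction $\beta$ and opening angle $\theta$, the number of lattice points in $S$ is at most $C\,\kappa_d(R)\left(1+R\theta^{1/(d-s)}\right)$.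
   Context: $S^{d-1}$ is the unit sphere in $\mathbb{R}^d$ centred at the origin $O$, $RS^{d-1}$ the sphere of radius $R$, $|\cdot|$ the Euclidean norm, $\overline{B}(\alpha,r)$ the closed ball of radius $r$ about $\alpha$. Rational quotients: $\beta\in\mathbb{R}^d$ is said to have $s$ rational quotients if there exists a non-zero $k\in\mathbb{R}$ such that $k\beta$ has exactly $s+1$ rational coordinates, and this number of rational coordinates is maximal amongst all non-zero real $k$. Spherical cap: for $\beta\in\mathbb{R}^d$ with $|\beta|=1$ and a radius $r$ with $0\le r\le 2R$, the spherical cap of direction $\beta$ and radius $r$ is $T=RS^{d-1}\cap\overline{B}(R\beta,r)$. Its base is $RS^{d-1}\cap\{x:|x-R\beta|=r\}$, a $(d-2)$-sphere lying in a hyperplane orthogonal to $\beta$. Spherical segment: a set $S=T_1\setminus T_2$, where $T_1,T_2$ are spherical caps of the same direction $\beta$ and radii $r_1>r_2$; $\beta$ is called the direction of $S$. Opening angle: the opening angle of a cap is the angle $\angle POQ$, where $P,Q$ are antipodal points of its base; explicitly, a cap of radius $r_i$ has opening angle $\theta_i\in[0,2\pi]$ determined by $r_i=2R\sin(\theta_i/4)$. The opening angle of the segment $S=T_1\setminus T_2$ is $\theta=\theta_1-\theta_2$, where $\theta_i$ is the opening angle of $T_i$. $\kappa_d(R)$ is the maximal number of points of $\mathbb{Z}^d$ in the intersection of $RS^{d-1}$ with a rational hyperplane, i.e. a hyperplane that can be defined by an equation $a_1x_1+\dots+a_dx_d=a$ with integers $a_1,\dots,a_d$ (not all zero) and $a$.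 *)

(* Defs.v *)
From HB Require Import structures.
From mathcomp Require Import all_boot all_order all_algebra finmap.
From mathcomp Require Import all_classical all_reals all_analysis.
Set Implicit Arguments.
Unset Strict Implicit.
Unset Printing Implicit Defensive.
Import Order.TTheory GRing.Theory Num.Theory.
Local Open Scope classical_set_scope.
Local Open Scope ring_scope.

(* The library norm on 'rV[R]_d is the sup norm, hence this Euclidean one. *)
Definition enorm (R : realType) (d : nat) (x : 'rV[R]_d) : R :=
  Num.sqrt (\sum_(i < d) x ord0 i ^+ 2).

Definition sphere (R : realType) (d : nat) (rho : R) : set 'rV[R]_d :=
  [set x | enorm x = rho].

Definition lattice (R : realType) (d : nat) : set 'rV[R]_d :=
  [set x | forall i, x ord0 i \is a Num.int].

(* fset_set sends infinite sets to fset0; only subsets of spheres are counted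
   below, and these are finite by finite_lattice_sphere. *)
Definition nb_lattice (R : realType) (d : nat) (A : set 'rV[R]_d) : nat :=
  #|` fset_set (A `&` @lattice R d)|%fset.

Definition nb_rational (R : realType) (d : nat) (x : 'rV[R]_d) : nat :=
  #|[pred i : 'I_d | x ord0 i \in @rational R]|.

Definition has_rational_quotients (R : realType) (d s : nat)
    (beta : 'rV[R]_d) : Prop :=
  (exists2 k : R, k != 0 & nb_rational (k *: beta) = s.+1) /\
  (forall k : R, k != 0 -> (nb_rational (k *: beta) <= s.+1)%N).

Definition spherical_cap (R : realType) (d : nat) (rho : R)
    (beta : 'rV[R]_d) (r : R) : set 'rV[R]_d :=
  @sphere R d rho `&` closed_ball_ (@enorm R d) (rho *: beta) r.

Definition cap_opening_angle (R : realType) (rho r theta : R) : Prop :=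
  0 <= theta <= 2 * pi /\ r = 2 * rho * sin (theta / 4).

Definition is_spherical_segment (R : realType) (d : nat) (rho : R)
    (beta : 'rV[R]_d) (theta : R) (S : set 'rV[R]_d) : Prop :=
  exists r1 r2 theta1 theta2 : R,
    [/\ 0 <= r2, r2 < r1 & r1 <= 2 * rho] /\
    [/\ cap_opening_angle rho r1 theta1,
        cap_opening_angle rho r2 theta2,
        theta = theta1 - theta2 &
        S = spherical_cap rho beta r1 `\` spherical_cap rho beta r2].

Definition is_rational_hyperplane (R : realType) (d : nat)
    (H : set 'rV[R]_d) : Prop :=
  exists (a : 'rV[int]_d) (b : int), a != 0 /\
    H = [set x | \sum_(i < d) (a ord0 i)%:~R * x ord0 i = b%:~R].

Definition is_kappa (R : realType) (d : nat) (rho : R) (n : nat) : Prop :=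
  (exists2 H : set 'rV[R]_d, is_rational_hyperplane H &
     n = nb_lattice (@sphere R d rho `&` H)) /\
  (forall H : set 'rV[R]_d, is_rational_hyperplane H ->
     (nb_lattice (@sphere R d rho `&` H) <= n)%N).

(* The maximum exists as soon as 0 < d, by kappaP. *)
Definition kappa (R : realType) (d : nat) (rho : R) : nat :=
  xget 0%N [set n | @is_kappa R d rho n].

Lemma finite_lattice_sphere (R : realType) (d : nat) (rho : R) :
  finite_set (@sphere R d rho `&` @lattice R d).
Proof.
pose N := Num.bound rho.
pose f (v : 'rV['I_(N + N).+1]_d) : 'rV[R]_d :=
  \row_i ((v ord0 i)%:R - N%:R).
apply: (@sub_finite_set _ _ (f @` setT)); last first.
  exact/finite_image/finite_finset.
move=> x [/= xrho xint].
have xle i : `|x ord0 i| <= N%:R.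
  have : `|x ord0 i| <= rho.
    rewrite -xrho /enorm -sqrtr_sqr ler_wsqrtr// (bigD1 i)//= lerDl.
    by apply: sumr_ge0 => j _; exact: sqr_ge0.
  move=> h; apply/(le_trans h)/ltW/archi_boundP.
  exact: le_trans (normr_ge0 _) h.
have ex i : exists m : 'I_(N + N).+1, x ord0 i = m%:R - N%:R.
  have /intrP[z xz] := xint i.
  have := xle i; rewrite xz ler_norml -[N%:R]/((Posz N)%:~R) -mulrNz !ler_int.
  move=> /andP[zl zu].
  have z0 : (0 <= z + N%:Z)%R by rewrite -lerBlDr sub0r.
  have mlt : (`|(z + N%:Z)%R| < (N + N).+1)%N.
    by by rewrite ltnS -lez_nat gez0_abs// PoszD lerD2r.
  exists (Ordinal mlt) => /=.
  by rewrite -[X in X - _]/((Posz `|(z + N%:Z)%R|%N)%:~R) gez0_abs// intrD addrK.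
have [g gP] := choice ex.
exists (\row_i g i) => //; apply/rowP => i.
by rewrite !mxE -gP.
Qed.

Lemma kappaP (R : realType) (d : nat) (rho : R) : (0 < d)%N ->
  @is_kappa R d rho (@kappa R d rho).
Proof.
move=> d0; apply: (@xgetPex _ 0%N [set n | @is_kappa R d rho n]).
pose P n := `[< exists2 H : set 'rV[R]_d, is_rational_hyperplane H &
     n = nb_lattice (@sphere R d rho `&` H) >].
have exP : exists n, P n.
  pose H := [set x : 'rV[R]_d |
    \sum_(i < d) ((const_mx 1 : 'rV[int]_d) ord0 i)%:~R * x ord0 i = 0%:~R].
  exists (nb_lattice (@sphere R d rho `&` H)); apply/asboolP.
  exists H => //; exists (const_mx 1), 0; split=> //.
  by apply/eqP => /rowP/(_ (Ordinal d0)); rewrite !mxE => /eqP; rewrite oner_eq0.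
have ubP n : P n -> (n <= nb_lattice (@sphere R d rho))%N.
  move=> /asboolP[H _ ->]; apply: fsubset_leq_card.
  rewrite -fset_set_sub.
  - by move=> x [[]].
  - by apply: sub_finite_set (@finite_lattice_sphere R d rho) => x [[]].
  - exact: finite_lattice_sphere.
have [n /asboolP Pn maxn] := ex_maxnP exP ubP.
by exists n; split=> // H hH; apply: maxn; apply/asboolP; exists H.
Qed.

(* Main.v *)
Require Import Defs.
From mathcomp Require Import all_boot all_order all_algebra finmap.
From mathcomp Require Import all_classical all_reals all_analysis.
From mathcomp Require Import ring lra.
Import numFieldNormedType.Exports.
Import Order.TTheory GRing.Theory Num.Theory.
Local Open Scope classical_set_scope.
Local Open Scope ring_scope.

(* The lattice points x of the segment lie on a sphere of radius rho and have
   <beta, x> confined to an interval of length O(rho theta).  Scale beta so that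
   s + 1 coordinates become rational, clear their denominators by D, and apply
   Dirichlet's simultaneous approximation to the d - s - 1 other coordinates:
   D q k beta is within D / Q of an integer vector p, with q <= Q ^ (d - s - 1).
   Then the integer <p, x> ranges over an interval of length
   O(q rho theta + rho / Q), and each of its values confines x to one rational
   hyperplane, carrying at most kappa lattice points.  The two error terms
   balance for Q of order theta ^ (- 1 / (d - s)); bounding theta forces 1 / Q to
   be smaller than some coordinate of k beta, which excludes p = 0. *)

(** * Simultaneous Diophantine approximation *)

(** Pigeonhole: cut the unit cube into [Q ^ #|I|] boxes of side [1 / Q]. Among the multiples of [a]
    by [0, ..., Q ^ #|I|], two have fractional parts in the same box, and [q] is the difference of
    their multipliers. *)
Lemma dirichlet_approximation (R : realType) (I : finType) (a : I -> R)
    (Q : nat) : (0 < Q)%N ->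
  exists (q : nat) (p : I -> int), (0 < q <= Q ^ #|I|)%N /\
    forall i, `|q%:R * a i - (p i)%:~R| <= Q%:R^-1.
Proof.
case: Q => // Q _; set N := (_ ^ _)%N.
pose fr (k : nat) i : R := k%:R * a i - (Num.floor (k%:R * a i))%:~R.
have fr_itv k i : 0 <= fr k i < 1.
  have := floor_itv (k%:R * a i); rewrite /fr intrD1; lra.
pose f (k : 'I_N.+1) : {ffun I -> 'I_Q.+1} :=
  [ffun i => inord (Num.trunc (Q.+1%:R * fr k i))].
have /injectivePn[k1 [k2 k12 fk12]] : ~~ injectiveb f.
  apply/negP => /injectiveP/leq_card.
  by rewrite card_ffun !card_ord ltnn.
wlog lt21 : k1 k2 k12 fk12 / (k2 < k1)%N.
  move=> h; have := k12; rewrite -val_eqE neq_ltn => /orP[lt12|lt21].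
  - by apply: (h k2 k1); rewrite // eq_sym.
  - exact: (h k1 k2).
exists (k1 - k2)%N, (fun i => Num.floor (k1%:R * a i) - Num.floor (k2%:R * a i)).
split=> [|i].
  by rewrite subn_gt0 lt21 (leq_trans (leq_subr _ _))// -ltnS.
have -> : (k1 - k2)%:R * a i -
    (Num.floor (k1%:R * a i) - Num.floor (k2%:R * a i))%:~R = fr k1 i - fr k2 i.
  by rewrite natrB ?(ltnW lt21)// intrB /fr; ring.
have Q0 : 0 < Q.+1%:R :> R by rewrite ltr0n.
have tr_itv (k : 'I_N.+1) : (f k i)%:R <= Q.+1%:R * fr k i < (f k i)%:R + 1.
  have /andP[fr0 fr1] := fr_itv k i.
  have Qfr0 : 0 <= Q.+1%:R * fr k i by rewrite mulr_ge0// ltW.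
  rewrite ffunE inordK; first by rewrite natr1; exact: truncn_itv.
  by rewrite truncn_lt_nat// gtr_pMr.
have := tr_itv k1; have := tr_itv k2; rewrite fk12 => h2 h1.
rewrite -[_^-1]mul1r ler_pdivlMr// -[X in _ * X](gtr0_norm Q0) -normrM.
by rewrite ler_norml; lra.
Qed.

Lemma common_denominator (R : realType) (d : nat) (x : 'rV[R]_d) :
  exists2 D : nat, (0 < D)%N &
    forall i, x ord0 i \in rational -> D%:R * x ord0 i \is a Num.int.
Proof.
have /choice[r rP] i : exists r : rat, x ord0 i \in rational -> x ord0 i = ratr r.
  have [/set_mem[r _ <-]|] := boolP (x ord0 i \in rational); first by exists r.
  by exists 0.
exists (\prod_i `|denq (r i)|)%N => [|i /rP ->].
  by apply: prodn_gt0 => i; rewrite absz_gt0 denq_neq0.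
rewrite (bigD1 i)//= natrM mulrAC rpredM ?natr_int//.
rewrite natr_absz gtr0_norm ?denq_gt0// /ratr mulrC divfK ?intr_int//.
by rewrite intr_eq0 denq_neq0.
Qed.

(** Multiplication by [D] makes the rational coordinates integers, so only the others enter the
    Dirichlet exponent; the price is a factor [D] in the error. *)
Lemma rational_coordinates_approximation (R : realType) (d : nat) (x : 'rV[R]_d) :
  exists2 D : nat, (0 < D)%N &
    forall Q : nat, (0 < Q)%N -> exists (q : nat) (p : 'rV[int]_d),
      (0 < q <= Q ^ (d - nb_rational x))%N /\
      forall i, `|(D * q)%:R * x ord0 i - (p ord0 i)%:~R| <= D%:R / Q%:R.
Proof.
have [D D0 DP] := common_denominator R d x; exists D => // Q Q0.
pose I := {i : 'I_d | x ord0 i \notin rational}.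
have [q [p [qQ pP]]] := dirichlet_approximation R I (fun i => x ord0 (val i)) Q Q0.
have cardI : #|{: I}| = (d - nb_rational x)%N.
  rewrite card_sig -[X in (X - _)%N]card_ord /nb_rational.
  by rewrite -(cardC [pred i | x ord0 i \in rational]) addKn; apply: eq_card.
exists q, (\row_i if insub i is Some j then p j *+ D
                  else Num.floor ((D * q)%:R * x ord0 i)).
split; first by rewrite -cardI.
move=> i; rewrite mxE; case: insubP => [j _ <-|].
  rewrite raddfMn/= natrM -(mulr_natl (_%:~R)) -mulrA -mulrBr normrM normr_nat.
  by apply: ler_wpM2l => //; exact: pP.
rewrite negbK => /DP xi; have -> : (D * q)%:R * x ord0 i = q%:R * (D%:R * x ord0 i).
  by rewrite natrM -mulrA mulrCA.
rewrite floorK ?subrr ?normr0 ?divr_ge0// rpredM ?natr_int//.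
Qed.

(** * Geometry of spherical segments *)

Lemma ler_sinB (R : realType) (a b : R) :
  0 <= a - b -> sin a - sin b <= a - b.
Proof.
rewrite subr_ge0 => ba.
have [|c _ ->] := @MVT_segment R sin cos b a ba (fun x _ => is_derive_sin x).
  by apply: continuous_subspaceT; exact: continuous_sin.
by apply: ler_piMl; rewrite ?subr_ge0 ?cos_le1.
Qed.

Lemma enorm_sqr (R : realType) (d : nat) (x : 'rV[R]_d) :
  enorm x ^+ 2 = \sum_(i < d) x ord0 i ^+ 2.
Proof. by rewrite sqr_sqrtr// sumr_ge0// => i _; exact: sqr_ge0. Qed.

Lemma ler_coord_enorm (R : realType) (d : nat) (x : 'rV[R]_d) i :
  `|x ord0 i| <= enorm x.
Proof.
rewrite -sqrtr_sqr ler_wsqrtr// (bigD1 i)//= lerDl.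
by apply: sumr_ge0 => j _; exact: sqr_ge0.
Qed.

Lemma enorm_sqrB (R : realType) (d : nat) (x y : 'rV[R]_d) :
  enorm (x - y) ^+ 2 = enorm x ^+ 2 + enorm y ^+ 2
    - 2 * \sum_(i < d) x ord0 i * y ord0 i.
Proof.
rewrite !enorm_sqr mulr_sumr -big_split -sumrB/=; apply: eq_bigr => i _.
by rewrite !mxE; ring.
Qed.

(** On the sphere, the squared distance from [x] to [rho *: beta] is affine in the inner product of
    [beta] and [x], which thus ranges over a length at most [(r1 ^+ 2 - r2 ^+ 2) / (2 * rho)]. Now
    [r1 - r2 <= rho * theta / 2] by [ler_sinB], and [r1 + r2 <= 4 * rho]. *)
Lemma spherical_segment_slab {R : realType} {d : nat} {beta : 'rV[R]_d}
    {rho theta : R} {S : set 'rV[R]_d} :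
    enorm beta = 1 -> 0 < rho -> 0 < theta ->
    is_spherical_segment rho beta theta S ->
  S `<=` @sphere R d rho /\
  exists c : R, forall x, S x ->
    `|\sum_(i < d) beta ord0 i * x ord0 i - c| <= rho * theta.
Proof.
move=> beta1 rho0 theta0 [r1 [r2 [t1 [t2 []]]]].
move=> [r2_ge0 r21 r1_le] [[t1P r1E] [t2P r2E] thetaE ->].
split; first by move=> x [[]].
(* This is the value of the inner product on the base of the outer cap, the lower end of the
   slab. *)
exists (rho - r1 ^+ 2 / (2 * rho)) => x [[xrho /= x1] x2].
have x2' : r2 < enorm (rho *: beta - x).
  by rewrite ltNge; apply/negP => h; apply: x2; split.
have : enorm (rho *: beta - x) ^+ 2 =
   2 * rho * (rho - \sum_(i < d) beta ord0 i * x ord0 i).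
  rewrite enorm_sqrB xrho.
  have -> : enorm (rho *: beta) ^+ 2 = rho ^+ 2.
    rewrite -[RHS]mulr1 -[X in _ * X](expr1n _ 2) -beta1 !enorm_sqr mulr_sumr.
    by apply: eq_bigr => i _; rewrite mxE exprMn.
  under eq_bigr do rewrite mxE -mulrA.
  by rewrite -mulr_sumr; ring.
set y := \sum_(i < d) _; set e := enorm _ in x1 x2' *; move=> yE.
have {yE} -> : y = rho - e ^+ 2 / (2 * rho) by rewrite yE; field; lra.
have -> : rho - e ^+ 2 / (2 * rho) - (rho - r1 ^+ 2 / (2 * rho)) =
    (r1 ^+ 2 - e ^+ 2) / (2 * rho) by field; lra.
have x1' : e <= r1 by exact: x1.
have h1 : e ^+ 2 <= r1 ^+ 2 by rewrite ler_sqr ?nnegrE; lra.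
have h2 : r2 ^+ 2 <= e ^+ 2 by rewrite ler_sqr ?nnegrE; lra.
rewrite ger0_norm; last by rewrite divr_ge0//; lra.
rewrite ler_pdivrMr; last by lra.
have r12 : r1 - r2 <= rho * theta / 2.
  rewrite r1E r2E -mulrBr.
  have /ler_sinB/(ler_wpM2l (ltW rho0)) : 0 <= t1 / 4 - t2 / 4 by lra.
  rewrite thetaE; lra.
have : (r1 - r2) * (r1 + r2) <= rho * theta / 2 * (4 * rho).
  by apply: ler_pM => //; lra.
lra.
Qed.

(** * Counting by parallel rational hyperplanes *)

(** Induction on [N], removing the last hyperplane [j = N], which costs at most [kappa d rho]. *)
Lemma nb_lattice_slab (R : realType) (d : nat) (rho : R) (A : set 'rV[R]_d)
    (p : 'rV[int]_d) (z : int) (N : nat) : (0 < d)%N -> p != 0 ->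
  A `<=` @sphere R d rho ->
  (forall x, A x -> @lattice R d x -> exists2 j : nat, (j < N)%N &
      \sum_(i < d) (p ord0 i)%:~R * x ord0 i = (z + j%:Z)%:~R) ->
  (nb_lattice A <= N * kappa d rho)%N.
Proof.
move=> d0 p0; elim: N A => [|N IH] A Arho Ap.
  rewrite mul0n leqn0 cardfs_eq0 (_ : A `&` _ = set0) ?fset_set0//.
  by rewrite -subset0 => x [Ax /(Ap x Ax)[]].
pose H := [set x : 'rV[R]_d |
  \sum_(i < d) (p ord0 i)%:~R * x ord0 i = (z + N%:Z)%:~R].
have finB (B : set 'rV[R]_d) : B `<=` @sphere R d rho ->
    finite_set (B `&` @lattice R d).
  move=> Brho; apply: sub_finite_set (@finite_lattice_sphere R d rho).
  exact: setSI.
have hH : (nb_lattice (@sphere R d rho `&` H) <= kappa d rho)%N.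
  by apply: (@kappaP R d rho d0).2; exists p, (z + N%:Z).
have hA : (nb_lattice (A `\` H) <= N * kappa d rho)%N.
  apply: IH => [x [/Arho]//|x [Ax Hx] xlat].
  have [j jN xj] := Ap x Ax xlat; exists j => //.
  by move: jN; rewrite ltnS leq_eqVlt => /predU1P[jN|//]; case: Hx; rewrite /H/= xj jN.
rewrite mulSn addnC; apply: leq_trans (leq_add hA hH).
apply: leq_trans (leq_trans _ (leq_addr _ _)) _; last by rewrite -cardfsUI.
apply: fsubset_leq_card; rewrite -fset_setU; try by apply: finB => x [].
- rewrite -fset_set_sub; first last.
  + by rewrite finite_setU; split; apply: finB => x []// /Arho.
  + exact: finB.
  move=> x [Ax xlat]; have [Hx|Hx] := pselect (H x); [right|left] => //.
  by split=> //; split=> //; exact: Arho.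
- by apply: finB => x [] /Arho.
Qed.

(** A closed interval of length [2 * L] may contain one integer more than the integer part of its
    length, hence the successor. *)
Lemma int_dist_window {R : realType} {c L : R} {n : int} : `|n%:~R - c| <= L ->
  exists2 j : nat, (j < (Num.trunc (2 * L)).+1)%N & n = Num.ceil (c - L) + j%:Z.
Proof.
rewrite ler_norml => /andP[h1 h2].
have cn : Num.ceil (c - L) <= n by rewrite ceil_le_int; lra.
have jE : (`|(n - Num.ceil (c - L))%R|%N)%:Z = n - Num.ceil (c - L).
  by rewrite gez0_abs// subr_ge0.
exists `|(n - Num.ceil (c - L))%R|%N; last by rewrite jE addrC subrK.
rewrite -(@ltr_nat R); apply: le_lt_trans (truncnS_gt _).
have -> : `|(n - Num.ceil (c - L))%R|%N%:R = (n - Num.ceil (c - L))%:~R :> R.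
  by rewrite -jE.
have /andP[_ h] := ceil_itv (c - L).
by rewrite intrB; lra.
Qed.

(** * Choice of the parameters and final count *)

Theorem theorem1p5 (R : realType) (d s : nat) (beta : 'rV[R]_d)
    (hd : (2 <= d)%N) (hs1 : (1 <= s)%N) (hs2 : (s <= d - 1)%N)
    (hbeta : enorm beta = 1) (hq : has_rational_quotients s beta) :
  exists C theta0 rho0 : R,
    [/\ 0 < C, 0 < theta0 & 0 < rho0] /\
    forall (rho theta : R) (S : set 'rV[R]_d),
      rho0 <= rho -> 0 < theta -> theta <= theta0 ->
      is_spherical_segment rho beta theta S ->
      (nb_lattice S)%:R <=
        C * (kappa d rho)%:R * (1 + rho * theta `^ (((d - s)%N%:R)^-1)).
Proof.
have [[k k0 nbk] _] := hq.
have d0 : (0 < d)%N by rewrite (leq_trans _ hd).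
have [D D0 approx] := rational_coordinates_approximation R d (k *: beta).
(* [m] counts the irrational coordinates of [k *: beta]. *)
pose m := (d - s.+1)%N; rewrite nbk -/m in approx.
have dsE : (d - s)%N = m.+1 by rewrite /m subnSK// (leq_ltn_trans hs2)// ltn_subrL.
have [i0 bi0] : exists i0, beta ord0 i0 != 0.
  apply/existsP; apply: contraT => /existsPn b0.
  have : enorm beta ^+ 2 = 0.
    rewrite enorm_sqr big1// => i _.
    by have := b0 i; rewrite negbK => /eqP ->; rewrite expr0n.
  by rewrite hbeta expr1n => /eqP; rewrite oner_eq0.
pose g := `|k * beta ord0 i0|.
have g0 : 0 < g by rewrite normr_gt0 mulf_neq0.
(* The first term comes from the width of the slab, through [q * theta <= 2 ^ m * tau]; the second
   from [d] coordinate errors, each at most [D * tau]. *)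
pose C0 : R := D%:R * `|k| * 2 ^+ m + d%:R * D%:R.
have C0_ge0 : 0 <= C0 by rewrite addr_ge0 ?mulr_ge0.
(* The bound [1] on [theta] gives [tau <= 1], used for [Q <= 2 / tau]; the bound [g ^+ m.+1] gives
   [tau <= g], used for [p != 0]. *)
exists (1 + 2 * C0), (Num.min 1 (g ^+ m.+1)), 1.
split; first by rewrite lt_min ltr01 exprn_gt0//; split=> //; lra.
move=> rho theta S rho1 theta0; rewrite le_min => /andP[theta1 thetag] segS.
have rho0 : 0 < rho by lra.
rewrite dsE; set tau := _ `^ _.
have tau0 : 0 < tau by rewrite powR_gt0.
have tauX : tau ^+ m.+1 = theta.
  by rewrite -powR_mulrn ?ltW// -powRrM mulVf ?pnatr_eq0// powRr1// ltW.
have tau1 : tau <= 1 by rewrite -(@ler_pXn2r _ m.+1) ?nnegrE ?expr1n ?tauX// ltW.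
have taug : tau <= g by rewrite -(@ler_pXn2r _ m.+1) ?nnegrE ?tauX// ltW.
pose Q := (Num.trunc tau^-1).+1.
have [q [p [/andP[q0 qQ] pP]]] := approx Q isT.
have Q0 : 0 < Q%:R :> R by rewrite ltr0n.
have QV : Q%:R^-1 < tau.
  by rewrite -[ltRHS]invrK ltf_pV2 ?posrE ?invr_gt0// truncnS_gt.
have Qle : Q%:R <= 2 / tau.
  have : (Num.trunc tau^-1)%:R <= tau^-1 by rewrite truncn_le invr_ge0 ltW.
  have : 1 <= tau^-1 by rewrite invf_ge1.
  by rewrite /Q -natr1; lra.
have qtheta : q%:R * theta <= 2 ^+ m * tau.
  have -> : 2 ^+ m * tau = (2 / tau) ^+ m * theta.
    rewrite -tauX expr_div_n exprS; field.
    by rewrite expf_neq0// gt_eqF.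
  rewrite ler_pM2r//; apply: le_trans (_ : Q%:R ^+ m <= _).
    by rewrite -natrX ler_nat.
  by rewrite lerXn2r ?nnegrE ?divr_ge0// ltW.
(* If [p = 0], coordinate [i0] yields [q * g <= 1 / Q < tau <= g], against [q >= 1]. *)
have p0 : p != 0.
  apply/eqP => p0; have := pP i0; rewrite p0 !mxE subr0 normrM normr_nat -/g.
  rewrite natrM -mulrA ler_pM2l ?ltr0n// => qg.
  have : 1 * g <= q%:R * g by rewrite ler_pM2r// ler1n.
  lra.
have [Srho [c cP]] := spherical_segment_slab hbeta rho0 theta0 segS.
pose dot (x : 'rV[R]_d) := \sum_(i < d) (p ord0 i)%:~R * x ord0 i.
have dotP x : S x -> `|dot x - (D * q)%:R * k * c| <= C0 * rho * tau.
  move=> Sx.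
  have -> : dot x - (D * q)%:R * k * c =
      (D * q)%:R * k * (\sum_(i < d) beta ord0 i * x ord0 i - c) -
      \sum_(i < d) ((D * q)%:R * (k *: beta) ord0 i - (p ord0 i)%:~R) * x ord0 i.
    rewrite mulrBr mulr_sumr addrAC -sumrB; congr (_ - _).
    by apply: eq_bigr => i _; rewrite mxE; ring.
  apply: le_trans (ler_normB _ _) _; rewrite /C0 !mulrDl; apply: lerD.
    rewrite !normrM normr_nat natrM.
    apply: le_trans (ler_wpM2l _ (cP x Sx)) _; first by rewrite !mulr_ge0.
    have := ler_wpM2l (_ : 0 <= D%:R * `|k| * rho) qtheta.
    by rewrite !mulr_ge0// ?(ltW rho0)// => /(_ isT); lra.
  apply: le_trans (ler_norm_sum _ _ _) _.
  apply: le_trans (_ : \sum_(i < d) D%:R * rho * tau <= _); last first.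
    by rewrite sumr_const card_ord -(mulr_natl (D%:R * rho * tau)) !mulrA.
  apply: ler_sum => i _; rewrite normrM mulrAC.
  apply: ler_pM => //; last by rewrite -(Srho x Sx) ler_coord_enorm.
  by apply: le_trans (pP i) _; rewrite ler_wpM2l// ltW.
pose L := C0 * rho * tau.
have := @nb_lattice_slab R d rho S p (Num.ceil ((D * q)%:R * k * c - L))
  (Num.trunc (2 * L)).+1 d0 p0 Srho.
have latP x : S x -> lattice x -> exists2 j : nat,
    (j < (Num.trunc (2 * L)).+1)%N &
    dot x = (Num.ceil ((D * q)%:R * k * c - L) + j%:Z)%:~R.
  move=> Sx xlat; have /intrP[n nE] : dot x \is a Num.int.
    by apply: rpred_sum => i _; rewrite rpredM ?intr_int.
  have := dotP x Sx; rewrite nE => /int_dist_window[j jL ->].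
  by exists j.
move=> /(_ latP); rewrite -(@ler_nat R) => /le_trans; apply.
have L0 : 0 <= L by rewrite !mulr_ge0// ltW.
have trL : (Num.trunc (2 * L))%:R <= 2 * L by rewrite truncn_le mulr_ge0.
(* What remains is [1 + 2 * C0 * rho * tau <= (1 + 2 * C0) * (1 + rho * tau)]. *)
rewrite natrM mulrAC ler_wpM2r// -natr1.
have : 0 <= rho * tau by rewrite mulr_ge0// ltW.
move: trL; rewrite /L; lra.
Qed.
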